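(* Let $\lambda\in\mathbb{R}$ and let $f(x)=\sum_{k=0}^{\infty}a_kx^k$ be a formal power series. For every integer $n\ge 0$, $$x^{n\lambda}\left(x^{1-\lambda}\frac{d}{dx}\right)^{n}f(x)=\sum_{l=0}^{n}{n \brace l}_{\lambda}x^{l}\left(\frac{d}{dx}\right)^{l}f(x)=\left(x\frac{d}{dx}\right)_{n,\lambda}f(x).$$
   Context: For $\lambda\in\mathbb{R}$, the degenerate falling factorials are $(x)_{0,\lambda}=1$ and $(x)_{n,\lambda}=x(x-\lambda)(x-2\lambda)\cdots(x-(n-1)\lambda)$ for $n\ge 1$; the falling factorials are $(x)_0=1$, $(x)_n=x(x-1)\cdots(x-n+1)$ for $n\ge1$. The degenerate Stirling numbers of the second kind ${n \brace k}_{\lambda}$ ($0\le k\le n$) are defined by the polynomial identity $(x)_{n,\lambda}=\sum_{k=0}^{n}{n \brace k}_{\lambda}(x)_k$, $n\ge 0$. The operator $\left(x\frac{d}{dx}\right)_{n,\lambda}$ is the degenerate falling factorial of the operator $\theta=x\frac{d}{dx}$: it is the identity for $n=0$ and $\theta(\theta-\lambda)\cdots(\theta-(n-1)\lambda)$ for $n\ge1$. The operator $\left(x^{1-\lambda}\frac{d}{dx}\right)^n$ is the $n$-fold composition of $h\mapsto x^{1-\lambda}\,\frac{dh}{dx}$. Powers of $x$ with real exponents are treated formally, by $\frac{d}{dx}x^{\alpha}=\alpha x^{\alpha-1}$ and $x^\alpha x^\beta=x^{\alpha+\beta}$ for $\alpha,\beta\in\mathbb{R}$, and the operators act termwise on series.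 *)

(* Defs.v *)
From mathcomp Require Import all_boot all_order all_algebra.
From mathcomp Require Import all_classical reals.

Set Implicit Arguments.
Unset Strict Implicit.
Unset Printing Implicit Defensive.
Import Order.TTheory GRing.Theory Num.Theory.
Local Open Scope ring_scope.

Definition fallpoly (R : nzRingType) (n : nat) : {poly R} :=
  \prod_(i < n) ('X - i%:R%:P).

Definition dfallpoly (R : nzRingType) (lambda : R) (n : nat) : {poly R} :=
  \prod_(i < n) ('X - (i%:R * lambda)%:P).

Lemma dstirling2_exists (R : comNzRingType) (lambda : R) (n : nat) :
  exists c : 'I_n.+1 -> R,
    dfallpoly lambda n = \sum_(k < n.+1) c k *: fallpoly R k.
Proof.
suff [c cE] : exists c : nat -> R,
    dfallpoly lambda n = \sum_(k < n.+1) c k *: fallpoly R k.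
  by exists (fun k => c k).
elim: n => [|n [c IH]].
  by exists (fun=> 1); rewrite big_ord1 scale1r /dfallpoly /fallpoly !big_ord0.
exists (fun k => (if k is j.+1 then c j else 0) +
  (if (k < n.+1)%N then (k%:R - n%:R * lambda) * c k else 0)).
rewrite [LHS]big_ord_recr /= -/(dfallpoly lambda n) IH mulr_suml.
under [RHS]eq_bigr do rewrite scalerDl.
rewrite big_split /= [X in _ = X + _]big_ord_recl /= scale0r add0r.
rewrite [X in _ = _ + X]big_ord_recr /= ltnn scale0r addr0 -big_split /=.
apply: eq_bigr => k _; rewrite ltn_ord /bump /= add1n.
rewrite [fallpoly R k.+1]big_ord_recr /= -/(fallpoly R k).
rewrite -scalerAl [(_ * c k)]mulrC -scalerA -scalerDr; congr (_ *: _).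
rewrite -mul_polyC polyCB [(_ - _) * fallpoly R k]mulrC -mulrDr.
by congr (_ * _); rewrite addrA subrK.
Qed.

Lemma dstirling2_unique (R : comNzRingType) (n : nat) (c d : 'I_n.+1 -> R) :
  \sum_(k < n.+1) c k *: fallpoly R k = \sum_(k < n.+1) d k *: fallpoly R k ->
  c =1 d.
Proof.
have szf k : size (fallpoly R k) = k.+1.
  rewrite /fallpoly -(big_map (fun i : 'I_k => i%:R) xpredT (fun r => 'X - r%:P)).
  by rewrite size_prod_XsubC size_map /index_enum -enumT size_enum_ord.
have lcf k : (fallpoly R k)`_k = 1.
  by have /monicP := monic_prod_XsubC (index_enum 'I_k) xpredT (fun i => i%:R : R);
    rewrite lead_coefE -/(fallpoly R k) szf.
suff key m (e : nat -> R) : \sum_(k < m) e k *: fallpoly R k = 0 ->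
    forall k, (k < m)%N -> e k = 0.
  move=> cd k; apply/eqP; rewrite -subr_eq0; apply/eqP.
  have := key n.+1 (fun j => c (inord j) - d (inord j)) _ k (ltn_ord k).
  rewrite inord_val; apply.
  under eq_bigr do rewrite inord_val scalerBl.
  by rewrite sumrB cd subrr.
elim: m => [//|m IH]; rewrite big_ord_recr /= => s0.
have em0 : e m = 0.
  move/(congr1 (fun p : {poly R} => p`_m)): s0.
  rewrite coefD coefZ lcf mulr1 coef_sum big1 ?add0r ?coef0 // => k _.
  by rewrite coefZ nth_default ?mulr0 // szf ltn_ord.
move: s0; rewrite em0 scale0r addr0 => /IH s0 k.
by rewrite ltnS leq_eqVlt => /orP[/eqP->|/s0].
Qed.

Definition dstirling2 (R : comNzRingType) (lambda : R) (n : nat) :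
    'I_n.+1 -> R :=
  projT1 (cid (dstirling2_exists lambda n)).
Arguments dstirling2 {R} lambda n k.

Lemma dstirling2P (R : comNzRingType) (lambda : R) (n : nat) :
  dfallpoly lambda n =
    \sum_(k < n.+1) dstirling2 lambda n k *: fallpoly R k.
Proof. exact: projT2 (cid (dstirling2_exists lambda n)). Qed.

(* A formal series with real exponents, sum over a in R of (h a) x^a, is
   encoded by its coefficient function h.  No condition on the support is
   needed: only sums, scalings, shifts by a monomial and termwise derivatives
   are used, never the product of two series. *)
Notation genseries R := (R -> R^o).

Definition monomial (R : realType) (a : R) : genseries R :=
  fun b => (b == a)%:R.

Definition xpow (R : realType) (b : R) (h : genseries R) : genseries R :=
  fun a => h (a - b).

(* d/dx (c x^(a+1)) = (a+1) c x^a *)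
Definition ddx (R : realType) (h : genseries R) : genseries R :=
  fun a => (a + 1) * h (a + 1).

Lemma xpow_monomial (R : realType) (a b : R) :
  xpow b (monomial a) = monomial (b + a).
Proof. by apply/funext => c; rewrite /xpow /monomial subr_eq addrC. Qed.

Lemma ddx_monomial (R : realType) (a : R) :
  ddx (monomial a) = a *: monomial (a - 1).
Proof.
apply/funext => c; rewrite /ddx /monomial /= scalrfctE /GRing.scale/= eq_sym -subr_eq eq_sym.
by case: eqP => [->|_]; rewrite ?mulr0// subrK.
Qed.

Definition powerseries (R : realType) (a : nat -> R) : genseries R :=
  fun b => if b \is a Num.nat then a (Num.truncn b) else 0.

Lemma powerseries_nat (R : realType) (a : nat -> R) (k : nat) :
  powerseries a k%:R = a k.
Proof. by rewrite /powerseries natr_nat natrK. Qed.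

Definition theta (R : realType) (h : genseries R) : genseries R :=
  xpow 1 (ddx h).

(* T (T - lambda) ... (T - (n-1) lambda), as a composition of operators *)
Fixpoint dfallop (R : realType) (lambda : R)
    (T : genseries R -> genseries R) (n : nat) (h : genseries R) :
    genseries R :=
  if n is m.+1 then dfallop lambda T m (T h - (m%:R * lambda) *: h) else h.

(* Main.v *)
Require Import Defs.
From mathcomp Require Import all_boot all_order all_algebra.
From mathcomp Require Import all_classical reals.

Set Implicit Arguments.
Unset Strict Implicit.
Unset Printing Implicit Defensive.
Import Order.TTheory GRing.Theory Num.Theory.
Local Open Scope ring_scope.

(** The three operators are diagonal on monomials: each multiplies the
coefficient of x^b by the value at b of a polynomial, whatever the series.
For theta this multiplier is b, so the degenerate falling factorial of theta
has multiplier (b)_{n,lambda} ([dfallop_thetaE]).  Each application of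
x^(1-lambda) d/dx lowers the exponent by lambda, so iterating it on x^b
yields the factors b, b - lambda, b - 2 lambda, and so on; the prefactor
x^(n lambda) restores the exponent, and the multiplier is again
(b)_{n,lambda} ([xpow_iter_ddxE]).  The case lambda = 1 of that computation
says that x^l (d/dx)^l has multiplier (b)_l ([xpow_iter_ddx1E]).  The middle
sum therefore has multiplier sum_l S(n,l) (b)_l, which is (b)_{n,lambda} by
the identity defining the degenerate Stirling numbers S(n,l), evaluated
at b. *)

Lemma horner_dfallpolyS (R : comNzRingType) (c : R) (n : nat) (b : R) :
  (dfallpoly c n.+1).[b] = (dfallpoly c n).[b] * (b - n%:R * c).
Proof. by rewrite /dfallpoly big_ord_recr /= hornerM hornerXsubC. Qed.

Lemma dfallpoly1 (R : nzRingType) (n : nat) : dfallpoly (1 : R) n = fallpoly R n.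
Proof. by apply: eq_bigr => i _; rewrite mulr1. Qed.

Lemma xpow0 (R : realType) (h : genseries R) : xpow 0 h = h.
Proof. by apply/funext => b; rewrite /xpow subr0. Qed.

Lemma thetaE (R : realType) (h : genseries R) (b : R) : theta h b = b * h b.
Proof. by rewrite /theta /xpow /ddx subrK. Qed.

Lemma dfallop_thetaE (R : realType) (c : R) (n : nat) (h : genseries R) (b : R) :
  dfallop c (@theta R) n h b = (dfallpoly c n).[b] * h b.
Proof.
elim: n h => [|n IH] h /=; first by rewrite /dfallpoly big_ord0 hornerC mul1r.
by rewrite IH horner_dfallpolyS -mulrA mulrBl -(thetaE h).
Qed.

(** The outermost of the n + 1 derivations meets the exponent already lowered
to b - n c, which is the new factor of (b)_{n+1,c}. *)
Lemma xpow_iter_ddxE (R : realType) (c : R) (n : nat) (h : genseries R) (b : R) :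
  xpow (n%:R * c) (iter n (fun g => xpow (1 - c) (ddx g)) h) b
    = (dfallpoly c n).[b] * h b.
Proof.
elim: n => [|n IH]; first by rewrite mul0r xpow0 /dfallpoly big_ord0 hornerC mul1r.
rewrite horner_dfallpolyS mulrAC -IH [RHS]mulrC iterS.
set g := iter n _ h; rewrite /xpow /ddx.
suff -> : b - n.+1%:R * c - (1 - c) + 1 = b - n%:R * c by [].
by rewrite -natr1 mulrDl mul1r opprD opprB !addrA !subrK.
Qed.

Lemma xpow_iter_ddx1E (R : realType) (l : nat) (h : genseries R) (b : R) :
  xpow l%:R (iter l (@ddx R) h) b = (fallpoly R l).[b] * h b.
Proof.
rewrite -dfallpoly1 -xpow_iter_ddxE mulr1; congr (xpow _ _ b).
by apply: eq_iter => g; rewrite subrr xpow0.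
Qed.

Lemma sum_dstirling2E (R : realType) (lambda : R) (n : nat) (h : genseries R)
    (b : R) :
  (\sum_(l < n.+1) dstirling2 lambda n l *: xpow l%:R (iter l (@ddx R) h)) b
    = (dfallpoly lambda n).[b] * h b.
Proof.
rewrite fct_sumE dstirling2P horner_sum mulr_suml; apply: eq_bigr => l _.
by rewrite hornerZ -mulrA -xpow_iter_ddx1E.
Qed.

Theorem theorem2p1 (R : realType) (lambda : R) (a : nat -> R) (n : nat) :
  let f : genseries R := powerseries a in
  xpow (n%:R * lambda) (iter n (fun h => xpow (1 - lambda) (ddx h)) f)
    = \sum_(l < n.+1) dstirling2 lambda n l *: xpow l%:R (iter l (@ddx R) f)
  /\
  \sum_(l < n.+1) dstirling2 lambda n l *: xpow l%:R (iter l (@ddx R) f)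
    = dfallop lambda (@theta R) n f.
Proof.
by split; apply/funext => b; rewrite sum_dstirling2E ?xpow_iter_ddxE ?dfallop_thetaE.
Qed.
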